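(* Let $(G,\omega)$ be a connected decorated planar graph of nilpotency degree zero. If the graph $\Gamma^{\mathrm{inv}}_{(G,\omega)}$ of invisible connected angular cycles is connected, then the directed graph $\mathcal{L}(G,\omega)$ is connected (as an undirected graph).
   Context: **Planar graphs.** $G=(V_G,E_G)$ is a finite connected undirected multigraph (multiple edges allowed) without loops, with every vertex of degree $\ge 2$, embedded in the oriented sphere $S^2$. An angle at a vertex $v$ is a pair of half-edges at $v$ that are consecutive in the clockwise cyclic order around $v$; it is oriented clockwise, from its source edge $s(a)$ to its target edge $t(a)$ (the next edge clockwise). $A_G$ is the set of angles. Every edge is the source of exactly two angles and the target of exactly two angles. The directed medial graph $\mathcal{Q}G$ has vertex set $E_G$ and one arrow $s(a)\to t(a)$ for each $a\in A_G$; $|\mathcal{Q}G|$ is its geometric realization, a 1-dimensional CW complex. **Weights.** A weight is a class $\omega\in H^1(|\mathcal{Q}G|;\mathbb{Z})$, and $(G,\omega)$ is called a decorated planar graph. An angular function is a map $g\colon A_G\to\mathbb{Z}_{\ge0}$; it is $\omega$-compatible if, viewed as a cellular 1-cochain of $|\mathcal{Q}G|$, it represents $\omega$. $\mathcal{L}(G,\omega)$ is the set of $\omega$-compatible angular functions. **Moves.** For $\epsilon\colon E_G\to\mathbb{Z}$ let $(\delta\epsilon)(a)=\epsilon(t(a))-\epsilon(s(a))$; $\chi_e$ is the characteristic function of $e\in E_G$. $g\in\mathcal{L}(G,\omega)$ is $e$-movable if $g+\delta\chi_e\ge0$ on $A_G$; then $\mathrm{mov}_e(g)=g+\delta\chi_e\in\mathcal{L}(G,\omega)$.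 $\mathcal{L}(G,\omega)$ is a directed graph: there is an edge $g\to\mathrm{mov}_e(g)$ for each $e$ such that $g$ is $e$-movable. **Nilpotency degree and invisible cycles.** An angular cycle is a cellular 1-cycle of $|\mathcal{Q}G|$ with non-negative coefficients in the basis of arrows; $\lambda_\omega(c)\in\mathbb{Z}$ is the value of $\omega$ on the class of $c$ (so $\lambda_\omega(c)=\sum_a c_a g(a)$ for any $\omega$-compatible $g$). $(G,\omega)$ has nilpotency degree zero if $\min\{\lambda_\omega(c): c\text{ a non-zero angular cycle}\}=0$. An invisible angular cycle is a non-zero angular cycle with $\lambda_\omega(c)=0$; it is connected if the arrows with non-zero coefficient form a connected subgraph of $\mathcal{Q}G$. The graph $\Gamma^{\mathrm{inv}}_{(G,\omega)}$ has as vertices the connected invisible angular cycles, two of them being joined by an edge precisely when they share a vertex of $\mathcal{Q}G$ (i.e. a common edge of $G$). *)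

(* Defs.v *)
From HB Require Import structures.
From Stdlib Require Import Relation_Operators.
From mathcomp Require Import all_boot all_order all_algebra all_fingroup.
From mathcomp Require Import boolp.
Set Implicit Arguments.
Unset Strict Implicit.
Unset Printing Implicit Defensive.
Import Order.TTheory GRing.Theory Num.Theory.
Local Open Scope ring_scope.
Local Open Scope quotient_scope.

(* Connectedness, as an undirected graph, of the possibly infinite directed
   graph on T with edge relation R; a connected graph is non-empty. *)
Definition graph_connected (T : Type) (R : T -> T -> Prop) : Prop :=
  inhabited T /\ forall x y : T, clos_refl_sym_trans T R x y.

(* A connected loopless multigraph with all degrees at least 2, embedded in
   the oriented sphere, is encoded by its rotation system: [rot h] is the half-edge
   following h clockwise around its vertex [vtx h], and [opp h] is the other
   half of the edge [edg h].  The faces of the embedding are the cycles of the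
   composition of [opp] and [rot]; for a connected graph the closed oriented
   surface defined by the rotation system is the sphere exactly when
   V - E + F = 2. *)
Record planarGraph := PlanarGraph {
  vertex : finType;
  edge : finType;
  half_edge : finType;
  vtx : half_edge -> vertex;
  edg : half_edge -> edge;
  opp : {perm half_edge};
  rot : {perm half_edge};
  oppK : involutive opp;
  opp_neq : forall h, opp h != h;
  edg_eq : forall h h', (edg h == edg h') = (h' == h) || (h' == opp h);
  edg_surj : forall e, exists h, edg h = e;
  vtx_eq : forall h h', (vtx h == vtx h') = (h' \in porbit rot h);
  no_loop : forall h, vtx (opp h) != vtx h;
  degree_ge2 : forall v, (2 <= #|[set h | vtx h == v]|)%N;
  planar_connected : graph_connected
    (fun u v : vertex => exists h, vtx h = u /\ vtx (opp h) = v);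
  planar_euler :
    (#|vertex| + #|porbits (opp * rot)%g| = #|edge| + 2)%N
}.

Section DecoratedPlanarGraphs.
Variable G : planarGraph.
Implicit Types (a : half_edge G) (e : edge G).

(* The angle (h, rot h) is represented by its first half-edge h. *)
Definition angle : finType := half_edge G.

Definition src (a : angle) : edge G := edg a.
Definition tgt (a : angle) : edge G := edg (rot G a).

(* Cellular 1-(co)chains of the directed medial graph, whose vertices are the
   edges of G and whose arrows are the angles a : src a -> tgt a. *)
Definition cochain := {ffun angle -> int}.
Definition chain := {ffun angle -> int}.

Definition delta (eps : {ffun edge G -> int}) : cochain :=
  [ffun a => eps (tgt a) - eps (src a)].

Definition coboundary : {pred cochain} :=
  fun g => `[< exists eps, g = delta eps >].

Fact coboundary_zmod_closed : zmod_closed coboundary.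
Proof.
split=> [|_ _ /asboolP[eps ->] /asboolP[eta ->]]; apply/asboolP.
  by exists 0; apply/ffunP=> a; rewrite !ffunE subrr.
exists (eps - eta); apply/ffunP=> a; rewrite !ffunE.
by rewrite !opprD !opprK addrACA.
Qed.
HB.instance Definition _ :=
  GRing.isZmodClosed.Build cochain coboundary coboundary_zmod_closed.

(* H^1(|QG|; Z): a 1-dimensional complex has no 2-cochains, so that every
   1-cochain is a cocycle. *)
Definition weight := Quotient.quot (coboundary : zmodClosed cochain).

Definition angular_function (g : cochain) : bool := [forall a, 0 <= g a].

Definition compatible (w : weight) (g : cochain) : bool :=
  \pi_weight g == w.

Definition angular_functions (w : weight) : Type :=
  {g : cochain | angular_function g && compatible w g}.

Definition chi e : {ffun edge G -> int} := [ffun e' => (e' == e)%:R].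

Definition mov e (g : cochain) : cochain := g + delta (chi e).

Definition movable e (g : cochain) : bool := angular_function (mov e g).

Definition move_rel (w : weight) (g g' : angular_functions w) : Prop :=
  exists e, movable e (val g) /\ val g' = mov e (val g).

Definition cycle_condition (c : chain) : bool :=
  [forall e, \sum_(a | tgt a == e) c a == \sum_(a | src a == e) c a].

Definition angular_cycle (c : chain) : bool :=
  [forall a, 0 <= c a] && cycle_condition c.

(* The pairing of w with the class of the cycle c; by [lambdaE] it can be
   computed with any representative of w. *)
Definition lambda (w : weight) (c : chain) : int :=
  \sum_(a : angle) c a * (generic_quotient.repr w : cochain) a.

Definition nilpotency_degree_zero (w : weight) : Prop :=
  (exists c, [/\ angular_cycle c, c != 0 & lambda w c = 0]) /\
  (forall c, angular_cycle c -> c != 0 -> 0 <= lambda w c).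

Definition invisible (w : weight) (c : chain) : bool :=
  [&& angular_cycle c, c != 0 & lambda w c == 0].

Definition visits (c : chain) e : bool :=
  [exists a, (c a != 0) && ((src a == e) || (tgt a == e))].

Definition support_adj (c : chain) : rel (edge G) := fun e e' =>
  [exists a, (c a != 0) && (((src a == e) && (tgt a == e'))
                            || ((src a == e') && (tgt a == e)))].

Definition connected_support (c : chain) : bool :=
  [forall e, forall e',
     visits c e ==> visits c e' ==> connect (support_adj c) e e'].

Definition inv_vertex (w : weight) : Type :=
  {c : chain | invisible w c && connected_support c}.

Definition inv_adj (w : weight) (c c' : inv_vertex w) : Prop :=
  exists e, visits (val c) e && visits (val c') e.

Lemma compatibleP w g g' : compatible w g ->
  reflect (exists eps, g' = g + delta eps) (compatible w g').
Proof.
move=> /eqP <-; rewrite /compatible -Quotient.idealrBE.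
apply: (iffP (asboolP _)) => -[eps].
  by move=> E; exists eps; rewrite -E addrC subrK.
by move=> ->; exists eps; rewrite addrC addKr.
Qed.

Lemma mov_compatible w e g : compatible w g -> compatible w (mov e g).
Proof. by move=> wg; apply/(compatibleP _ wg); exists (chi e). Qed.

Lemma sum_cycle_delta c eps :
  cycle_condition c -> \sum_(a : angle) c a * delta eps a = 0.
Proof.
move=> /forallP cyc.
under eq_bigr do rewrite ffunE mulrBr.
rewrite sumrB (partition_big tgt xpredT) //= [X in _ - X](partition_big src xpredT) //=.
rewrite -sumrB big1 // => e _.
under eq_bigr => a /eqP -> do [].
under [X in _ - X]eq_bigr => a /eqP -> do [].
by rewrite -!mulr_suml (eqP (cyc e)) subrr.
Qed.

Lemma lambdaE w c g : cycle_condition c -> compatible w g ->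
  lambda w c = \sum_(a : angle) c a * g a.
Proof.
move=> cyc wg.
have /(compatibleP _ wg) [eps E] : compatible w (generic_quotient.repr w)
  by rewrite /compatible reprK.
rewrite /lambda; under eq_bigr do rewrite E ffunE mulrDr.
by rewrite big_split /= sum_cycle_delta // addr0.
Qed.

End DecoratedPlanarGraphs.

(* Main.v *)
From Stdlib Require Import Relation_Operators.
From mathcomp Require Import all_boot all_order all_algebra.
From mathcomp Require Import boolp zify.
Require Import Defs.
Set Implicit Arguments.
Unset Strict Implicit.
Unset Printing Implicit Defensive.
Import Order.TTheory GRing.Theory Num.Theory.
Local Open Scope ring_scope.

(** Two compatible angular functions g and g' differ by some [delta eps].
    Both vanish on every invisible cycle, so [eps] is constant on each connected
    invisible cycle, hence, by connectedness of the graph of these cycles,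
    constant on the set U of all edges they visit; subtracting the constant,
    [eps] vanishes on U.  Passing through g + delta (max eps 0) reduces to
    eps >= 0.  If then no edge with eps > 0 were movable, each of them would have
    an outgoing arrow on which g = 0, whose target again satisfies eps > 0;
    following these arrows closes up to an invisible cycle outside U, which is
    absurd.  So some edge with eps > 0 can be moved, lowering the sum of [eps].
    Existence of a compatible angular function is the usual construction of a
    potential from shortest paths in a graph without negative cycles. *)

(** * Walks in the medial graph and the cycles they carry *)

Section Walks.
Variable G : planarGraph.
Implicit Types (a b : angle G) (e : edge G) (p q : seq (angle G)).

Fixpoint walk e p : bool :=
  if p is a :: q then (src a == e) && walk (tgt a) q else true.

Definition walk_end e p : edge G := last e (map (@tgt G) p).

Definition closed_walk e p : bool := walk e p && (walk_end e p == e).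

Definition walk_chain p : chain G := [ffun a => (count_mem a p)%:R].

Lemma walk_cat e p q : walk e (p ++ q) = walk e p && walk (walk_end e p) q.
Proof. by elim: p e => //= a p IH e; rewrite IH andbA. Qed.

(** For a closed walk the extra entries of the two lists agree; cancelling them shows that every
    edge occurs equally often as source and as target. *)
Lemma walk_vertices e p : walk e p ->
  e :: map (@tgt G) p = rcons (map (@src G) p) (walk_end e p).
Proof.
elim: p e => //= a p IH e /andP[/eqP <- wp].
by rewrite (IH _ wp).
Qed.

Lemma sum_walk_chain (p : seq (angle G)) (P : pred (angle G)) (f : angle G -> int) :
  \sum_(a | P a) walk_chain p a * f a = \sum_(a <- p | P a) f a.
Proof.
elim: p => [|b p IH].
  by rewrite big_nil big1 // => a _; rewrite ffunE mul0r.
rewrite big_cons -IH.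
under eq_bigr => a _ do rewrite ffunE /= natrD mulrDl.
rewrite big_split /=.
under [X in _ + X]eq_bigr do rewrite -(ffunE (fun a => (count_mem a p)%:R)).
rewrite (big_mkcond P) (bigD1 b) //= eqxx mul1r big1 ?addr0 => [|a /negPf ab].
  by case: ifP => _; rewrite ?add0r.
by rewrite eq_sym ab mul0r if_same.
Qed.

Lemma walk_chain_neq0 p a : (walk_chain p a != 0) = (a \in p).
Proof. by rewrite ffunE pnatr_eq0 -lt0n -has_count has_pred1. Qed.

Lemma closed_walk_cycle e p : closed_walk e p -> angular_cycle (walk_chain p).
Proof.
case/andP=> wp /eqP we; apply/andP; split.
  by apply/forallP=> a; rewrite ffunE ler0n.
apply/forallP=> e'; apply/eqP.
have sumE (h : angle G -> edge G) :
    \sum_(a | h a == e') walk_chain p a = (count_mem e' (map h p))%:R.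
  transitivity (\sum_(a | h a == e') walk_chain p a * 1).
    by apply: eq_bigr => a _; rewrite mulr1.
  by rewrite sum_walk_chain big_const_seq iter_addr_0 count_map.
rewrite !sumE; congr _%:R.
have := congr1 (count_mem e') (walk_vertices wp).
rewrite we -cats1 count_cat /= addn0 addnC => /eqP.
by rewrite eqn_add2r => /eqP.
Qed.

Lemma walk_chain_connected e p : walk e p -> connected_support (walk_chain p).
Proof.
move=> wp; pose adj := support_adj (walk_chain p).
have adj_sym : symmetric adj.
  by move=> x y; apply: eq_existsb => a; rewrite orbC.
(* Stated for [q] inside [p], so that the start advances in the induction while the adjacency stays
   that of [p]. *)
have reach q e' : walk e' q -> {subset q <= p} ->
    forall a, a \in q -> connect adj e' (src a) && connect adj e' (tgt a).
  elim: q e' => //= b q IH _ /andP[/eqP <- wq] sub a.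
  have step : connect adj (src b) (tgt b).
    apply/connect1/existsP; exists b.
    by rewrite walk_chain_neq0 sub ?mem_head // !eqxx.
  rewrite inE => /predU1P[->|aq]; first by rewrite connect0.
  have subq : {subset q <= p} by move=> x xq; apply: sub; rewrite inE xq orbT.
  have /andP[s t] := IH _ wq subq a aq.
  by rewrite !(connect_trans step).
have visitsP e' : visits (walk_chain p) e' -> connect adj e e'.
  case/existsP=> a /andP[]; rewrite walk_chain_neq0 => ap.
  have /andP[s t] := reach p e wp (fun _ => id) a ap.
  by case/orP=> /eqP <-.
apply/forallP=> x; apply/forallP=> y; apply/implyP=> vx; apply/implyP=> vy.
apply: connect_trans (visitsP y vy).
by rewrite (sym_connect_sym adj_sym) visitsP.
Qed.

(** Pigeonhole: the first [#|edge G|.+1] edges met when following [next] from [e] cannot be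
    distinct, and the stretch between two equal ones is closed. *)
Lemma closed_walk_exists (P : pred (edge G)) (next : edge G -> angle G) e :
  (forall e', P e' -> src (next e') = e' /\ P (tgt (next e'))) -> P e ->
  exists e' p, [/\ closed_walk e' p, p != [::]
    & forall a, a \in p -> exists2 e'', P e'' & a = next e''].
Proof.
move=> nextP Pe; pose f e' := tgt (next e').
have iterP n : P (iter n f e) by elim: n => //= n /nextP[].
have trajW n e' : P e' -> walk e' (map next (traject f e' n)).
  elim: n e' => //= n IH e' Pe'; have [-> Pt] := nextP _ Pe'.
  by rewrite eqxx IH.
have trajE n e' : walk_end e' (map next (traject f e' n)) = iter n f e'.
  by elim: n e' => // n IH e'; rewrite iterSr -IH.
have /injectivePn[i [j ij fij]] :
    ~~ injectiveb (fun k : 'I_#|edge G|.+1 => iter k f e).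
  apply/negP=> /injectiveP/leq_card.
  by rewrite card_ord ltnn.
wlog lt_ij : i j ij fij / (i < j)%N.
  move=> wl; case: (ltngtP i j) => [||/val_inj] H.
  - exact: wl H.
  - by apply: (wl j i) => //; rewrite eq_sym.
  - by rewrite H eqxx in ij.
exists (iter i f e), (map next (traject f (iter i f e) (j - i))); split.
- by rewrite /closed_walk trajW //= trajE -iterD subnK 1?ltnW // fij.
- by rewrite -size_eq0 size_map size_traject subn_eq0 -ltnNge.
move=> _ /mapP[x /trajectP[k _ ->] ->].
by exists (iter k f (iter i f e)); rewrite // -iterD.
Qed.

End Walks.

(** * Potentials from shortest walks *)

Section Potentials.
Variable G : planarGraph.
Implicit Types (e : edge G) (g : cochain G) (p : seq (angle G)).

Let simple_walk e p := walk e p && uniq (map (@src G) p).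

Lemma shortest_simple_walk g e : exists p, simple_walk e p /\
  forall q, simple_walk e q -> \sum_(a <- p) g a <= \sum_(a <- q) g a.
Proof.
(* A simple walk repeats no arrow, so its weight is at least [- B]; shifting by [B] reduces to a
   minimum over natural numbers. *)
pose B : int := \sum_a `|g a|.
have bound p : simple_walk e p -> 0 <= \sum_(a <- p) g a + B.
  case/andP=> _ /map_uniq up; rewrite (big_uniq _ up) /=.
  rewrite /B [X in _ + X](bigID (mem p)) /= addrA -big_split /=.
  apply: addr_ge0; apply: sumr_ge0 => a _ //.
  by rewrite -lerBlDr sub0r lerNnormlW.
pose P n := `[< exists2 p, simple_walk e p & \sum_(a <- p) g a + B = n%:Z >].
have wit p : simple_walk e p -> P (absz (\sum_(a <- p) g a + B)).
  by move=> sp; apply/asboolP; exists p; rewrite // gez0_abs ?bound.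
have exP : exists n, P n by eexists; apply: (wit [::]).
case: (ex_minnP exP) => n /asboolP[p sp pn] minn.
exists p; split=> // q sq; have := minn _ (wit q sq).
by rewrite -lez_nat gez0_abs ?bound // -pn lerD2r.
Qed.

Lemma potential_exists g :
  (forall e p, closed_walk e p -> 0 <= \sum_(a <- p) g a) ->
  exists eps, angular_function (g + delta eps).
Proof.
have consE a p : g a + \sum_(b <- p) g b = \sum_(b <- a :: p) g b by rewrite big_cons.
move=> closed_ge0.
have [sh shP] := choice (shortest_simple_walk g).
(* The potential of an edge is the least weight of a simple walk starting there, with free end; the
   claim becomes the triangle inequality for the arrow [a]. *)
exists [ffun e => \sum_(a <- sh e) g a]; apply/forallP=> a.
rewrite !ffunE addrA subr_ge0.
have [/andP[wp up] _] := shP (tgt a); have [_ minp] := shP (src a).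
move: wp up; set p := sh (tgt a) => wp up.
have [/mapP[b bp ab]|ap] := boolP (src a \in map (@src G) p); last first.
  rewrite consE; apply: minp.
  by rewrite /simple_walk /= eqxx wp ap up.
(* A repeated vertex splits off a closed walk, of non-negative weight. *)
case/splitPr: bp wp up => p1 p2.
rewrite walk_cat map_cat cat_uniq /= => /and3P[w1 /eqP sb w2] /and3P[_ _ u2].
rewrite big_cat /= addrA consE.
have cl : closed_walk (src a) (a :: p1).
  by rewrite /closed_walk /= eqxx w1 ab sb /walk_end /= eqxx.
apply: le_trans (lerD (closed_ge0 _ _ cl) (lexx _)); rewrite add0r.
by apply: minp; rewrite /simple_walk /= ab eqxx w2.
Qed.

End Potentials.

(** * Invisible cycles and connectedness under moves *)

Section Connectedness.
Variables (G : planarGraph) (w : weight G).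
Implicit Types (e : edge G) (eps : {ffun edge G -> int}).

Lemma add_deltaE (g : cochain G) eps (a : angle G) :
  (g + delta eps) a = g a + (eps (tgt a) - eps (src a)).
Proof. by rewrite !ffunE. Qed.

Lemma movE e (g : cochain G) (a : angle G) :
  mov e g a = g a + ((tgt a == e)%:R - (src a == e)%:R).
Proof. by rewrite add_deltaE !ffunE. Qed.

Lemma angular_function_exists : nilpotency_degree_zero w ->
  inhabited (angular_functions w).
Proof.
case=> _ cyc_ge0; pose g0 : cochain G := generic_quotient.repr w.
have wg0 : compatible w g0 by rewrite /compatible generic_quotient.reprK.
have [e p cl|eps geps] := @potential_exists G g0.
  have [->|nz] := eqVneq p [::]; first by rewrite big_nil.
  (* [lambda] is computed with [g0], so the weight of a closed walk is the value of [w] on its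
     angular cycle. *)
  rewrite -(sum_walk_chain p xpredT g0); apply: cyc_ge0.
    exact: closed_walk_cycle cl.
  case: p nz {cl} => // a p _; apply/eqP=> /ffunP/(_ a)/eqP.
  by rewrite [X in _ == X]ffunE; apply/negP; rewrite walk_chain_neq0 mem_head.
have wg : compatible w (g0 + delta eps) by apply/(compatibleP _ wg0); exists eps.
by constructor; exists (g0 + delta eps); rewrite geps.
Qed.

(** The value of [w] on the cycle is a sum of non-negative products [c a * g a]; being zero, it
    vanishes term by term. *)
Lemma invisible_eq0 (c : chain G) (g : angular_functions w) a :
  invisible w c -> c a != 0 -> val g a = 0.
Proof.
case/and3P=> /andP[/forallP c0 cyc] _ lam ca.
have /andP[/forallP g0 wg] := valP g.
move: lam; rewrite (lambdaE cyc wg) psumr_eq0 => [/allP/(_ a)|b _].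
  by rewrite mem_index_enum mulf_eq0 (negPf ca) /= => /(_ isT)/eqP.
exact: mulr_ge0.
Qed.

Lemma invisible_constant (g g' : angular_functions w) eps (c : inv_vertex w) e e' :
  val g' = val g + delta eps -> visits (val c) e -> visits (val c) e' ->
  eps e = eps e'.
Proof.
move=> gg' ve ve'; have /andP[inv /forallP/(_ e)/forallP/(_ e')] := valP c.
rewrite ve ve' /= => /connectP[p]; elim: p e {ve} => [|x p IH] e /=; first by move=> _ ->.
case/andP=> /existsP[a /andP[ca ex]] pth /(IH x pth) <-.
have /eqP := congr1 (fun h : cochain G => h a) gg'.
rewrite !ffunE !(invisible_eq0 _ inv ca) add0r eq_sym subr_eq0 => /eqP.
by case/orP: ex => /andP[/eqP <- /eqP <-].
Qed.

Lemma inv_vertex_visits (c : inv_vertex w) : exists e, visits (val c) e.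
Proof.
have /andP[/and3P[_ cn0 _] _] := valP c.
have [a ca] : exists a, val c a != 0.
  apply/existsP; apply: contraNT cn0; rewrite negb_exists => /forallP c0.
  by apply/eqP/ffunP=> a; rewrite [RHS]ffunE; apply/eqP/negPn.
by exists (src a); apply/existsP; exists a; rewrite ca eqxx.
Qed.

Lemma inv_connected_constant (g g' : angular_functions w) eps (c c' : inv_vertex w) :
  val g' = val g + delta eps -> clos_refl_sym_trans _ (@inv_adj G w) c c' ->
  forall e e', visits (val c) e -> visits (val c') e' -> eps e = eps e'.
Proof.
move=> gg'; elim=> {c c'} [c c' [x /andP[cx cx']]|c|c c' _ IH|c d c' _ IH1 _ IH2] e e' ve ve'.
- by rewrite (invisible_constant gg' ve cx) (invisible_constant gg' cx' ve').
- exact: invisible_constant gg' ve ve'.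
- by rewrite (IH e' e).
(* The middle cycle is non-zero, so it visits an edge through which the two equalities chain. *)
- have [x vx] := inv_vertex_visits d.
  by rewrite (IH1 e x) // (IH2 x e').
Qed.

Definition vanishes_on_invisible eps : Prop :=
  forall (c : inv_vertex w) e, visits (val c) e -> eps e = 0.

Lemma positive_movable_exists (g g' : angular_functions w) eps e :
  val g' = val g + delta eps -> vanishes_on_invisible eps -> 0 < eps e ->
  exists2 e', 0 < eps e' & movable e' (val g).
Proof.
move=> gg' eps0 epos; apply: contrapT => stuck.
have /andP[/forallP g_ge0 wg] := valP g.
have /andP[/forallP g'_ge0 _] := valP g'.
have outP x : exists a, 0 < eps x -> [/\ src a = x, val g a = 0 & 0 < eps (tgt a)].
  have [xpos|] := boolP (0 < eps x); last first.
    (* A default arrow, making [next] total; its value matters only where [eps] is positive. *)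
    by move=> _; have [h _] := edg_surj x; exists h.
  have /forallPn[a] : ~~ movable x (val g) by apply/negP=> mv; apply: stuck; exists x.
  move=> na; exists a => _; move: na (g_ge0 a) (g'_ge0 a).
  rewrite gg' movE add_deltaE -ltNge.
  (* An arrow blocking the move at [x] leaves [x], does not return to it and has [g a = 0]; then
     [g' a >= 0] gives [eps (tgt a) >= eps x > 0]. *)
  have [sa|_] := eqVneq (src a) x; last by case: eqP => _; lia.
  have [_|_] := eqVneq (tgt a) x; first by lia.
  rewrite sa => lt1 ge0 ge1.
  have ga0 : val g a = 0 by lia.
  by split=> //; move: ge1; rewrite ga0; lia.
have [next nextP] := choice outP.
have [|//|x [p [cl pn0 pP]]] :=
  @closed_walk_exists G (fun x => 0 < eps x) next e.
  by move=> x /nextP[].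
have pos_g a : a \in p -> 0 < eps (src a) /\ val g a = 0.
  by move=> /pP[y ypos ->]; have [-> ->] := nextP y ypos.
have ccl := closed_walk_cycle cl.
case: p pn0 cl ccl pos_g {pP} => // a p _ cl ccl pos_g.
have cn0 := walk_chain_neq0 (a :: p) a; rewrite mem_head in cn0.
have inv : invisible w (walk_chain (a :: p)).
  apply/and3P; split=> //.
    by apply/eqP=> E; rewrite E [X in X != _]ffunE eqxx in cn0.
  have /andP[_ cyc] := ccl.
  rewrite (lambdaE cyc wg) (sum_walk_chain _ xpredT) big_seq big1 // => b.
  by case/pos_g.
have conn : connected_support (walk_chain (a :: p)).
  by case/andP: cl => /walk_chain_connected.
have ic : invisible w (walk_chain (a :: p)) && connected_support (walk_chain (a :: p)).
  by rewrite inv.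
(* The contradiction: [eps] vanishes at the edges this invisible cycle visits, yet is positive at
   [src a]. *)
have [apos _] := pos_g a (mem_head a p).
have E : eps (src a) = 0.
  apply: (eps0 (exist _ (walk_chain (a :: p)) ic)); apply/existsP; exists a.
  by rewrite /= cn0 eqxx.
by rewrite E ltxx in apos.
Qed.

Lemma connected_above (g g' : angular_functions w) eps :
  val g' = val g + delta eps -> vanishes_on_invisible eps ->
  (forall e, 0 <= eps e) -> clos_refl_sym_trans _ (@move_rel G w) g g'.
Proof.
(* A move at [x] replaces [eps] by [eps - chi x], so the sum drops by one. *)
have [n] := ubnP (absz (\sum_e eps e)).
elim: n g eps => // n IH g eps; rewrite ltnS => le_n gg' eps0 eps_ge0.
have [/existsP[e0 epos]|] := boolP [exists e, 0 < eps e]; last first.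
  rewrite negb_exists => /forallP epsN.
  have -> : g' = g; last exact: rst_refl.
  apply: val_inj; rewrite gg'; apply/ffunP=> a; rewrite !ffunE.
  have Z e : eps e = 0 by apply/eqP; rewrite eq_le eps_ge0 leNgt epsN.
  by rewrite !Z subrr addr0.
have [x xpos mvx] := positive_movable_exists gg' eps0 epos.
have /andP[_ wg] := valP g.
have h1P : angular_function (mov x (val g)) && compatible w (mov x (val g)).
  by rewrite [angular_function _]mvx mov_compatible.
pose h1 : angular_functions w := exist _ (mov x (val g)) h1P.
apply: (rst_trans _ _ _ h1); first by apply: rst_step; exists x.
have chiE e : (eps - chi x) e = eps e - (e == x)%:R by rewrite !ffunE.
apply: (IH h1 (eps - chi x)).
- apply: leq_trans le_n; rewrite -ltz_nat !gez0_abs; last 2 first.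
  + exact: sumr_ge0.
  + apply: sumr_ge0 => e _; rewrite chiE.
    by have [->|_] := eqVneq e x; rewrite ?subr0 // subr_ge0 -gtz0_ge1.
  under eq_bigr do rewrite chiE.
  rewrite sumrB ltrBlDr ltrDl (bigD1 x) //= eqxx ltr_pwDl //.
  exact: sumr_ge0.
- rewrite gg' (_ : val h1 = mov x (val g)) //; apply/ffunP=> a.
  by rewrite add_deltaE [RHS]add_deltaE movE !chiE; lia.
(* No connected invisible cycle visits [x], as [eps x] is positive; subtracting [chi x] thus keeps
   the required zeros. *)
- move=> c e vc; rewrite chiE (eps0 c e vc).
  by have [E|_] := eqVneq e x; [rewrite -E (eps0 c e vc) ltxx in xpos|rewrite subr0].
- move=> e; rewrite chiE.
  by have [->|_] := eqVneq e x; rewrite ?subr0 // subr_ge0 -gtz0_ge1.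
Qed.

End Connectedness.

Theorem theorem3p23 (G : planarGraph) (w : weight G)
  (hnil : nilpotency_degree_zero w)
  (hinv : graph_connected (@inv_adj G w)) :
  graph_connected (@move_rel G w).
Proof.
split=> [|g g']; first exact: angular_function_exists.
have [[c0] inv_conn] := hinv; have [e0 ve0] := inv_vertex_visits c0.
have /andP[/forallP g_ge0 wg] := valP g.
have /andP[/forallP g'_ge0 wg'] := valP g'.
have [eps1 gg1] := compatibleP _ wg wg'.
pose eps : {ffun edge G -> int} := [ffun e => eps1 e - eps1 e0].
have gg' : val g' = val g + delta eps.
  by rewrite gg1; apply/ffunP=> a; rewrite !add_deltaE !ffunE; lia.
have eps0 : vanishes_on_invisible w eps.
  move=> c e ve; rewrite ffunE.
  by rewrite (inv_connected_constant gg1 (inv_conn c c0) ve ve0) subrr.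
pose up : {ffun edge G -> int} := [ffun e => Num.max (eps e) 0].
have hP : angular_function (val g + delta up) && compatible w (val g + delta up).
  apply/andP; split; last by apply/(compatibleP _ wg); exists up.
  (* If [eps (src a) <= 0], the added term is [up (tgt a) >= 0]; otherwise it is at least
     [delta eps a], so the value is at least [g' a]. *)
  apply/forallP=> a; have := g_ge0 a; have := g'_ge0 a.
  rewrite gg' !add_deltaE !(ffunE (fun e => Num.max (eps e) 0)).
  by case: (leP (eps (tgt a)) 0); case: (leP (eps (src a)) 0); lia.
pose h : angular_functions w := exist _ (val g + delta up) hP.
apply: (rst_trans _ _ _ h).
  apply: (@connected_above _ _ _ _ up) => //.
    by move=> c e ve; rewrite ffunE (eps0 c e ve) maxxx.
  by move=> e; rewrite ffunE le_max lexx orbT.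
(* [h] also lies above [g'], the difference being given by the negative part [up - eps] of [eps]. *)
apply: rst_sym; apply: (@connected_above _ _ _ _ (up - eps)).
- rewrite gg' /=; apply/ffunP=> a; rewrite !add_deltaE.
  by rewrite !(ffunE (fun e => up e + _)) !(ffunE (fun e => - eps e)); lia.
- move=> c e ve.
  by rewrite [LHS]ffunE [X in X + _]ffunE [X in _ + X]ffunE (eps0 c e ve) maxxx subr0.
- move=> e.
  by rewrite [leRHS]ffunE [X in X + _]ffunE [X in _ + X]ffunE subr_ge0 le_max lexx.
Qed.
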